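(* Let $n\ge 1$ and let $(G,x,y)$ be an $n$-isobicyclic triple. Then $(G,x,y)$ is isomorphic to a semidirect product of a $t$-isobicyclic triple $(T,x_T,y_T)$ by an $s$-isobicyclic triple $(S,x_S,y_S)$ (in the sense defined below), where (i) $n=st$ with $\gcd(s,t)=1$; (ii) $(S,x_S,y_S)$ is a cartesian product of $p_i^{e_i}$-isobicyclic triples for $i=1,\dots,k$, where $s=p_1^{e_1}\cdots p_k^{e_k}$ with the $p_i$ distinct primes; (iii) $(T,x_T,y_T)$ is the standard $t$-isobicyclic triple.
   Context: A group $G$ is $n$-isobicyclic if it has cyclic subgroups $X=\langle x\rangle$, $Y=\langle y\rangle$ of order $n$ with $G=XY$, $X\cap Y=1$, and there is an automorphism of $G$ transposing $x$ and $y$; $(G,x,y)$ is then an $n$-isobicyclic triple. Triples $(G,x,y)$, $(G',x',y')$ are isomorphic if some isomorphism $G\to G'$ sends $x\mapsto x'$, $y\mapsto y'$. The standard $t$-isobicyclic triple is $(T,x_T,y_T)$ with $T=\langle x_T,y_T\mid x_T^t=y_T^t=[x_T,y_T]=1\rangle\cong C_t\times C_t$. Cartesian product: if $(G_i,x_i,y_i)$ is $s_i$-isobicyclic ($i=1,\dots,k$) with the $s_i$ pairwise coprime, their cartesian product is $(G_1\times\cdots\times G_k,(x_1,\dots,x_k),(y_1,\dots,y_k))$, an $s_1\cdots s_k$-isobicyclic triple. Semidirect product: let $(S,x_S,y_S)$ be $s$-isobicyclic, $(T,x_T,y_T)$ the standard $t$-isobicyclic triple, $\gcd(s,t)=1$,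 and suppose there is $\lambda\in\mathbb Z_t^*$ and a homomorphism $\psi:S\to\mathrm{Aut}\,T$ with $x_T^{\psi(x_S)}=x_T$, $y_T^{\psi(x_S)}=y_T^{\lambda}$, $x_T^{\psi(y_S)}=x_T^{\lambda}$, $y_T^{\psi(y_S)}=y_T$ (a ''diagonal action with eigenvalue $\lambda$''). Then with $G=T\rtimes_\psi S$, $x=x_Sx_T$, $y=y_Sy_T$, the triple $(G,x,y)$ is $st$-isobicyclic; it is called the semidirect product of $(T,x_T,y_T)$ by $(S,x_S,y_S)$ (with eigenvalue $\lambda$). *)

(* Defs.v *)
From HB Require Import structures.
From mathcomp Require Import all_boot all_order all_algebra all_fingroup all_solvable.
Set Implicit Arguments. Unset Strict Implicit. Unset Printing Implicit Defensive.

Local Open Scope group_scope.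

Definition isobicyclic (gT : finGroupType) (n : nat) (G : {group gT}) (x y : gT)
  : Prop :=
  [/\ #[x] = n, #[y] = n, <[x]> * <[y]> = G, <[x]> :&: <[y]> = 1
    & exists a : {perm gT}, [/\ a \in Aut G, a x = y & a y = x]].

Definition triple_iso (gT hT : finGroupType) (G : {group gT}) (x y : gT)
  (H : {group hT}) (x' y' : hT) : Prop :=
  exists f : {morphism G >-> hT}, [/\ isom G H f, f x = x' & f y = y'].

Definition Cyc (t : nat) : finGroupType := 'I_t.-1.+1.
Definition cyc_gen (t : nat) : Cyc t := Zp1.

Definition stdT (t : nat) : {group (Cyc t * Cyc t)%type} := [set: (Cyc t * Cyc t)%type]%G.
Definition std_x (t : nat) : (Cyc t * Cyc t)%type := (cyc_gen t, 1).
Definition std_y (t : nat) : (Cyc t * Cyc t)%type := (1, cyc_gen t).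

Definition cart_prod_triple (gT : finGroupType) (S : {group gT}) (xS yS : gT)
  (k : nat) (Si : 'I_k -> {group gT}) (xi yi : 'I_k -> gT) : Prop :=
  [/\ \big[dprod/1]_(i < k) (Si i : {set gT}) = S,
      xS = \prod_(i < k) xi i & yS = \prod_(i < k) yi i].

(* (G, x, y) is (internally, hence up to isomorphism) the semidirect product of
   the triple (T, xT, yT) by (S, xS, yS) with a diagonal action of eigenvalue
   lam in (Z_t)^*: T is normal with complement S, x = xS xT, y = yS yT, and
   conjugation by S (the action psi, written exponentially) is diagonal. *)
Definition sdprod_triple (gT : finGroupType) (G : {group gT}) (x y : gT)
  (t : nat) (T : {group gT}) (xT yT : gT) (S : {group gT}) (xS yS : gT)
  (lam : nat) : Prop :=
  [/\ T ><| S = G, x = xS * xT, y = yS * yT, coprime lam t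
    & [/\ xT ^ xS = xT, yT ^ xS = yT ^+ lam, xT ^ yS = xT ^+ lam & yT ^ yS = yT]].

(* Main.v *)
(** A product of two cyclic groups is metabelian (Ito), hence solvable, and for
    every set pi of primes the pi-parts of <[x]> and <[y]> multiply to a Hall
    subgroup, which is again isobicyclic.  Some subgroup of prime order of <[x]>
    is normal in G, and so is its image in <[y]>; dividing out their product
    leaves a smaller isobicyclic triple.  Such quotients show by induction that,
    for the largest prime p dividing n, the Sylow p-subgroup P is normal, and
    that its complement H either centralises P, or P is abelian and H acts
    diagonally with an eigenvalue l such that l <> 1 modulo p.  By induction
    H = T' ><| S' with S' nilpotent.  In the first case P joins S'.  In the
    second case P joins T': the eigenvalue m of S' on T' satisfies m <> 1 modulo
    every prime divisor of the order of T', and this forces T' to centralise P. *)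
Require Import Defs.
From HB Require Import structures.
From mathcomp Require Import all_boot all_order all_algebra all_fingroup all_solvable.
Local Open Scope group_scope.

(** * Products of two abelian groups *)

(** Ito's argument: conjugating [[~ a, b]] by [a1 * b1] and by [b1 * a1] gives the same element,
    because writing [b ^ a1 = a2 * b2] and [a ^ b1 = b3 * a3] turns both into [[~ a3, b2]]. So the
    generators of [[~: A, B]], which contains the derived subgroup, commute. *)
Lemma ito_der1_abelian {gT : finGroupType} {A B G : {group gT}} :
  abelian A -> abelian B -> A * B = G -> abelian G^`(1).
Proof.
move=> cAA cBB defG.
have defG' : B * A = G.
  have/comm_group_setP : group_set (A * B) by rewrite defG groupP.
  by rewrite /commute defG => ->.
have sAG : A \subset G by rewrite -defG mulG_subl.
have sBG : B \subset G by rewrite -defG mulG_subr.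
have comA u v : u \in A -> v \in A -> [~ u, v] = 1.
  by move=> Au Av; apply/eqP/commgP; apply: (centsP cAA).
have comB u v : u \in B -> v \in B -> [~ u, v] = 1.
  by move=> Au Av; apply/eqP/commgP; apply: (centsP cBB).
have key a b a1 b1 : a \in A -> b \in B -> a1 \in A -> b1 \in B ->
  [~ a, b] ^ (a1 * b1) = [~ a, b] ^ (b1 * a1).
  move=> Aa Bb Aa1 Bb1.
  have: b ^ a1 \in A * B.
    by rewrite defG groupJ // ?(subsetP sAG _ Aa1) ?(subsetP sBG _ Bb).
  case/mulsgP=> a2 b2 Aa2 Bb2 e2.
  have: a ^ b1 \in B * A.
    by rewrite defG' groupJ // ?(subsetP sAG _ Aa) ?(subsetP sBG _ Bb1).
  case/mulsgP=> b3 a3 Bb3 Aa3 e3.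
  have eA : forall u, u \in A -> u ^ a1 = u.
    by move=> u Au; apply/conjg_fixP/eqP; apply: comA.
  have eB : forall u, u \in B -> u ^ b1 = u.
    by move=> u Au; apply/conjg_fixP/eqP; apply: comB.
  have red1 u : u \in A -> [~ u, a2 * b2] = [~ u, b2].
    by move=> Au; rewrite commgMJ (comA u a2) // conj1g mulg1.
  have red2 v : v \in B -> [~ b3 * a3, v] = [~ a3, v].
    by move=> Bv; rewrite commMgJ (comB b3 v) // conj1g mul1g.
  rewrite !conjgM (conjRg a b a1) eA // e2 red1 // conjRg e3 eB // red2 //.
  by rewrite (conjRg a b b1) e3 eB // red2 // conjRg eA // e2 red1.
have nAB : G \subset 'N([~: A, B]).
  by rewrite -defG mul_subG ?commg_norml ?commg_normr.
have sG' : G^`(1) \subset [~: A, B].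
  rewrite der1_min //= -defG quotientMl ?(subset_trans sAG) // abelianM.
  by rewrite !quotient_abelian //= centsC quotient_cents2r.
apply: abelianS sG' _.
have cc : forall a1 b1, a1 \in A -> b1 \in B -> [~: A, B] \subset 'C[[~ a1, b1]].
  move=> a1 b1 Aa1 Bb1; rewrite gen_subG; apply/subsetP=> _ /imset2P[a b Aa Bb ->].
  (* Inverses are used so that conjugating back by [a1 * b1] leaves [[~ a, b] ^ [~ a1, b1] =
     [~ a, b]]. *)
  have := key a b a1^-1 b1^-1 Aa Bb (groupVr Aa1) (groupVr Bb1).
  move/(congr1 (conjg^~ (a1 * b1))); rewrite -!conjgM => e.
  have -> : [~ a1, b1] = a1^-1 * b1^-1 * (a1 * b1) by rewrite commgEl /conjg !mulgA.
  by rewrite cent1C; apply/cent1P/esym/commgP/conjg_fixP; rewrite e -invMg mulVg conjg1.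
rewrite /abelian gen_subG; apply/subsetP=> _ /imset2P[a b Aa Bb ->].
by apply/centP=> c /(subsetP (cc a b Aa Bb)) /cent1P.
Qed.

Lemma product_abelian_solvable {gT : finGroupType} {A B G : {group gT}} :
  abelian A -> abelian B -> A * B = G -> solvable G.
Proof.
move=> cAA cBB defG; rewrite (series_sol (der_normal 1 G)).
by rewrite abelian_sol ?(ito_der1_abelian cAA cBB defG) // abelian_sol ?der_abelian.
Qed.

(** * Cyclic groups acting on abelian groups *)

(** As [X] is abelian, the fixed points in [E] of an element of [X] form an [X]-invariant subgroup,
    which irreducibility makes trivial or all of [E]. Hence the index is the length of the [C]-orbit
    of some [e != 1], and this orbit misses 1. *)
Lemma cyclic_irr_orbit {gT : finGroupType} {X E C : {group gT}} :
  cyclic X -> E :!=: 1 -> C \subset X ->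
  (forall F : {group gT}, F \subset E -> X \subset 'N(F) -> F :=: 1 \/ F :=: E) ->
  X \subset 'N(E) -> (#|C : 'C_C(E)| < #|E|)%N.
Proof.
move=> cycX ntE sCX irrE nEX.
have cXX := cyclic_abelian cycX.
have [e Ee nte] := trivgPn _ ntE.
have cE c : c \in X -> c \in 'C[e] -> c \in 'C(E).
  move=> Xc cec.
  case: (irrE 'C_E[c]%G (subsetIl _ _)).
  - rewrite normsI // (subset_trans _ (normG 'C[c]%G)) //.
    by rewrite sub_cent1 (subsetP cXX).
  - move=> /= F1; case/negP: nte; rewrite -in_set1 -[[set _]]F1 inE Ee.
    by rewrite cent1C.
  by move=> /= FE; rewrite -sub_cent1 -FE subsetIr.
have -> : 'C_C(E) = 'C_C[e].
  apply/eqP; rewrite eqEsubset; apply/andP; split.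
    by rewrite setIS // -cent_set1 centS // sub1set.
  apply/subsetP=> c /setIP[Cc ce]; rewrite inE Cc cE //.
  exact: (subsetP sCX).
rewrite index_cent1.
have/subset_leq_card : e ^: C \subset E :\ 1.
  rewrite subsetD1; apply/andP; split.
    by rewrite class_sub_norm // (subset_trans sCX).
  apply/negP=> /imsetP[c _ /esym/eqP].
  by rewrite conjg_eq1 (negPf nte).
by rewrite (cardsD1 1 E) group1.
Qed.

(* Take E minimal X-invariant in M and C the kernel of X on M / E.  If C does not
   centralise E, then, E being irreducible, every element of C centralising E
   centralises M: otherwise [~ m, b] would be an X-equivariant link from M / E to E
   on which C acts trivially. *)
Lemma card_cyclic_act_abelian {gT : finGroupType} {X M : {group gT}} :
  cyclic X -> abelian M -> X \subset 'N(M) -> M :!=: 1 ->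
  (#|X : 'C_X(M)| < #|M|)%N.
Proof.
have [k] := ubnP #|M|; elim: k => // k IHk in gT X M *; rewrite ltnS => leMk.
move=> cycX cMM nMX ntM.
have cXX := cyclic_abelian cycX.
have [|E /mingroupP[/andP[ntE nEX] minE] sEM] :=
  @mingroup_exists gT (fun H : {group gT} => (H :!=: 1) && (X \subset 'N(H))) M.
  by rewrite ntM.
have irrE (F : {group gT}) : F \subset E -> X \subset 'N(F) -> F :=: 1 \/ F :=: E.
  move=> sFE nFX; case: (eqVneq (F : {set _}) 1) => [|ntF]; [by left | right].
  by apply: minE; rewrite ?ntF.
have [eEM | neEM] := eqVneq (E : {set gT}) M.
  by rewrite -eEM; apply: cyclic_irr_orbit (subxx _) irrE nEX.
have nEM : M \subset 'N(E) by rewrite sub_abelian_norm.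
have ltME : (#|M / E| < #|M|)%N by rewrite ltn_quotient.
have ltI : (#|X / E : 'C_(X / E)(M / E)| < #|M / E|)%N.
  apply: IHk; rewrite ?quotient_cyclic ?quotient_abelian ?quotient_norms //.
    exact: leq_trans ltME leMk.
  rewrite -subG1 quotient_sub1 //; apply: contra neEM => sME.
  by rewrite eqEsubset sEM.
pose C := (X :&: coset E @*^-1 'C(M / E))%G.
have sCX : C \subset X by apply: subsetIl.
have nEC : C \subset 'N(E) by apply: subset_trans nEX.
have CP c : c \in X -> (forall m, m \in M -> [~ m, c] \in E) -> c \in C.
  move=> Xc cM; rewrite inE Xc /=; apply/morphpreP; split.
    exact: (subsetP nEX).
  apply/centP=> _ /morphimP[m Nm Mm ->].
  apply/esym/commgP; rewrite -morphR ?Nm ?(subsetP nEX _ Xc) //.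
  by apply/eqP/coset_id/cM.
have CE c m : c \in C -> m \in M -> [~ m, c] \in E.
  case/setIP=> Xc /morphpreP[Nc /centP cMc] Mm.
  have Nm := subsetP nEM m Mm.
  apply: coset_idr; first by rewrite groupR.
  by rewrite morphR //; apply/eqP/commgP/esym/cMc/mem_quotient.
have leXC : (#|X : C| < #|M / E|)%N.
  rewrite -(@index_quotient_eq _ _ E) //; last first.
    apply/subsetP=> c /setIP[Xc Ec]; apply: CP => // m Mm.
    have -> : [~ m, c] = 1; last exact: group1.
    by apply/eqP/commgP/(centsP cMM) => //; apply: (subsetP sEM).
  rewrite (_ : C / E = 'C_(X / E)(M / E)) //=.
  by rewrite [LHS]morphim_setIpre.
have leCB := cyclic_irr_orbit cycX ntE sCX irrE nEX.
have sDC : 'C_X(M) \subset 'C_C(E).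
  rewrite subsetI andbC (subset_trans (subsetIr _ _)) ?centS //=.
  apply/subsetP=> c /setIP[Xc cM]; apply: CP => // m Mm.
  have -> : [~ m, c] = 1; last exact: group1.
  by apply/eqP/commgP/commute_sym/(centP cM).
have sBX : 'C_C(E) \subset X by rewrite subIset ?sCX.
(* The index is split along the chain ['C_X(M)], ['C_C(E)], [C], [X]. The upper two factors are
   bounded by [leCB] and [leXC]; only the bottom one needs care. *)
rewrite -(Lagrange_index sBX sDC) -(Lagrange_index sCX (subsetIl C 'C(E))).
rewrite -(Lagrange sEM) [X in (_ < X)%N]mulnC -(card_quotient nEM).
have [sBD | ] := boolP ('C_C(E) \subset 'C_X(M)).
  rewrite (eqP (_ : #|'C_C(E) : 'C_X(M)| == 1)%N) ?indexg_eq1 // muln1.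
  by rewrite ltn_mul.
case/subsetPn=> b /setIP[Cb cEb] notDb.
have Xb := subsetP sCX b Cb.
have [m Mm ntmb] : exists2 m, m \in M & [~ m, b] != 1.
  apply/exists_inP; apply: contraR notDb; rewrite negb_exists => /forallP mb.
  rewrite inE Xb; apply/centP=> m Mm; apply/esym/commgP.
  by have := mb m; rewrite Mm negbK.
have sC_E : C \subset 'C(E).
  apply/subsetP=> c Cc.
  have Xc := subsetP sCX c Cc.
  have mbc : [~ m, b] ^ c = [~ m, b].
    rewrite conjRg.
    have -> : b ^ c = b by apply/conjg_fixP/commgP/(centsP cXX).
    have -> : m ^ c = m * [~ m, c] by rewrite commgEl mulKVg.
    rewrite commMgJ.
    have Em := CE c m Cc Mm; have Eb := CE b m Cb Mm.
    have -> : [~ [~ m, c], b] = 1.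
      by apply/eqP/commgP; rewrite /commute (centP cEb).
    rewrite mulg1; apply/conjg_fixP/commgP.
    by apply: (centsP (abelianS sEM cMM)).
  have : 'C_E[c] != 1.
    apply/trivgPn; exists [~ m, b] => //; rewrite inE CE //=.
    by rewrite cent1C; apply/cent1P/commute_sym/commgP/conjg_fixP.
  case: (irrE 'C_E[c]%G (subsetIl _ _)) => /= [||FE _].
  - rewrite normsI // (subset_trans _ (normG 'C[c]%G)) //.
    by rewrite sub_cent1 (subsetP cXX).
  - by move=> -> /eqP.
  by rewrite -sub_cent1 -FE subsetIr.
have -> : #|C : 'C_C(E)| = 1%N by apply/eqP; rewrite indexg_eq1 subsetI subxx.
have -> : #|'C_C(E) : 'C_X(M)| = #|C : 'C_X(M)|.
  by congr #|_ : _|; apply/setIidPl.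
rewrite muln1.
rewrite (leq_trans (_ : _ < #|M / E| * #|C : 'C_X(M)|)%N) //.
  by rewrite ltn_mul2r leXC indexg_gt0.
rewrite leq_mul2l; apply/orP; right.
(* For a generator [b0] of [C], [[~ m, b0]] lies in [E] and commutes with [b0], so
   [[~ m, b0 ^+ #|E|] = [~ m, b0] ^+ #|E| = 1]; thus [#|C : 'C_X(M)|] is at most [#|E|]. *)
have /cyclicP[b0 defC] := cyclicS sCX cycX.
have sDC' : 'C_X(M) \subset C by rewrite (subset_trans sDC) ?subsetIl.
have nDC : C \subset 'N('C_X(M)) by rewrite sub_abelian_norm ?(abelianS sCX).
have Cb0 : b0 \in C by rewrite defC cycle_id.
rewrite -(card_quotient nDC) defC quotient_cycle ?(subsetP nDC) //.
rewrite -orderE dvdn_leq ?cardG_gt0 // order_dvdn -morphX ?(subsetP nDC) //.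
apply/eqP/coset_id; rewrite inE groupX ?(subsetP sCX) //=.
apply/centP=> m1 Mm1; apply/esym/commgP.
have Em1 := CE b0 m1 Cb0 Mm1.
rewrite commgX; last first.
  exact: (centP (subsetP sC_E _ Cb0)).
by rewrite -order_dvdn order_dvdG.
Qed.

(** * Swaps, subtriples, quotients and Hall subgroups *)

Lemma isobicyclic_swap {gT : finGroupType} {n : nat} {G : {group gT}} {x y : gT} :
  isobicyclic n G x y ->
  exists f : {morphism G >-> gT}, [/\ 'injm f, f @* G = G, f x = y & f y = x].
Proof.
case=> _ _ _ _ [a [Aa ax ay]].
by exists (autm_morphism Aa); rewrite /= injm_autm im_autm.
Qed.

Lemma isobicyclic_gen {gT : finGroupType} {n : nat} {G : {group gT}} {x y : gT} :
  isobicyclic n G x y -> [/\ x \in G, y \in G & #|G| = (n * n)%N].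
Proof.
case=> ox oy defG tiXY _.
by rewrite -!cycle_subG -defG mulG_subl mulG_subr TI_cardMg // -!orderE ox oy.
Qed.

(** The image contains both generators, so the morphism is onto, hence injective by counting. *)
Lemma isobicyclic_of_morphism {gT : finGroupType} {n : nat} {G : {group gT}}
    {x y : gT} (f : {morphism G >-> gT}) :
  #[x] = n -> #[y] = n -> <[x]> * <[y]> = G -> <[x]> :&: <[y]> = 1 ->
  f x = y -> f y = x -> isobicyclic n G x y.
Proof.
move=> ox oy defG tiXY fx fy; split=> //.
have [Gx Gy]: x \in G /\ y \in G by rewrite -!cycle_subG -defG mulG_subl mulG_subr.
have fG : f @* G = G.
  rewrite -[X in f @* X]defG morphimMl ?cycle_subG // !morphim_cycle // fx fy.
  by have/comm_group_setP <- : group_set (<[x]> * <[y]>) by rewrite defG groupP.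
have injf : 'injm f by rewrite -card_im_injm fG.
by exists (aut injf fG); rewrite Aut_aut !autE.
Qed.

Lemma isobicyclic_sym {gT : finGroupType} {n : nat} {G : {group gT}} {x y : gT} :
  isobicyclic n G x y -> isobicyclic n G y x.
Proof.
case=> ox oy defG tiXY [a [Aa ax ay]]; split=> //; last by exists a.
  by have/comm_group_setP <- : group_set (<[x]> * <[y]>) by rewrite defG groupP.
by rewrite setIC.
Qed.

Lemma isobicyclic_solvable {gT : finGroupType} {n : nat} {G : {group gT}} {x y : gT} :
  isobicyclic n G x y -> solvable G.
Proof.
by case=> _ _ defG _ _; apply: product_abelian_solvable defG; apply: cycle_abelian.
Qed.

Lemma isobicyclic_sub {gT : finGroupType} {n i : nat} {G H : {group gT}} {x y : gT} :
  isobicyclic n G x y -> <[x ^+ i]> * <[y ^+ i]> = H ->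
  isobicyclic #[x ^+ i] H (x ^+ i) (y ^+ i).
Proof.
move=> isoG defH; have [ox oy defG tiXY _] := isoG.
have [Gx Gy _] := isobicyclic_gen isoG.
have [f [_ _ fx fy]] := isobicyclic_swap isoG.
have sHG : H \subset G by rewrite -defH mul_subG // cycle_subG groupX.
apply: (isobicyclic_of_morphism (restrm_morphism sHG f)) => //.
- by rewrite !orderXgcd ox oy.
- by apply/trivgP; rewrite -tiXY setISS // cycle_subG mem_cycle.
- by rewrite /= /restrm morphX ?fx.
- by rewrite /= /restrm morphX ?fy.
Qed.

Lemma TI_mulg_inj {gT : finGroupType} {A B : {group gT}} {a b c d : gT} :
  A :&: B = 1 -> a \in A -> c \in A -> b \in B -> d \in B ->
  a * b = c * d -> a = c /\ b = d.
Proof.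
move=> tiAB Aa Ac Bb Bd e.
have e1 : c^-1 * a = d * b^-1 by apply: (mulgI c); apply: (mulIg b); rewrite mulKVg mulgA mulgKV.
have : c^-1 * a \in A :&: B by rewrite inE {2}e1 !groupM ?groupV.
rewrite tiAB => /set1P e2; split.
  by apply: (mulgI c^-1); rewrite e2 mulVg.
by apply: (mulIg b^-1); rewrite -e1 e2 mulgV.
Qed.

(** The swap exchanges the two generators of [N], so it descends to [G / N]. Uniqueness of
    factorisation in [G] makes the images of the two cyclic groups meet trivially. *)
Lemma isobicyclic_quotient {gT : finGroupType} {n m : nat} {G N : {group gT}} {x y : gT} :
  isobicyclic n G x y -> (m %| n)%N -> N <| G -> <[x ^+ m]> * <[y ^+ m]> = N ->
  isobicyclic m (G / N)%G (coset N x) (coset N y).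
Proof.
move=> isoG dv_m_n nNG defN; have [ox oy defG tiXY _] := isoG.
have [Gx Gy oG] := isobicyclic_gen isoG.
have n_gt0 : (0 < n)%N by rewrite -ox order_gt0.
have [f [_ _ fx fy]] := isobicyclic_swap isoG.
have nNsG := normal_norm nNG; have sNG := normal_sub nNG.
have Nx := subsetP nNsG x Gx; have Ny := subsetP nNsG y Gy.
have coset_order z : z \in G -> #[z] = n -> <[z]> :&: N = <[z ^+ m]> ->
    #[coset N z] = m.
  move=> Gz oz tiz.
  have Nz := subsetP nNsG z Gz.
  rewrite orderE -quotient_cycle // card_quotient ?cycle_subG // -indexgI tiz.
  have : <[z ^+ m]> \subset <[z]> by rewrite cycle_subG mem_cycle.
  move/divgS <-; rewrite -!orderE orderXdiv oz // divnA ?mulKn //.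
have sXX : <[x ^+ m]> \subset <[x]> by rewrite cycle_subG mem_cycle.
have sYY : <[y ^+ m]> \subset <[y]> by rewrite cycle_subG mem_cycle.
have XN : <[x]> :&: N = <[x ^+ m]>.
  rewrite -defN setIC -group_modl // [_ :&: <[x]>](_ : _ = 1) ?mulg1 //.
  by apply/trivgP; rewrite -tiXY /= setIC setIS.
have YN : <[y]> :&: N = <[y ^+ m]>.
  rewrite -defN -group_modr // [<[y]> :&: _](_ : _ = 1) ?mul1g //.
  by apply/trivgP; rewrite -tiXY /= setIC setSI.
(* This is the domain of the composite [coset N \o f]. It is shown to cover [G], so that the
   factored map can be restricted to [G / N]. *)
pose H0 := (f @*^-1 'N(N))%G.
have sH0G : H0 \subset 'N(N) by rewrite (subset_trans _ nNsG) // subsetIl.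
have fN : f @* N \subset N.
  rewrite -[X in f @* X]defN morphimMl ?cycle_subG ?groupX //.
  rewrite !morphim_cycle ?groupX // !morphX // fx fy.
  have/comm_group_setP <- : group_set (<[x ^+ m]> * <[y ^+ m]>) by rewrite defN groupP.
  by rewrite defN.
have sK : 'ker (coset N) \subset 'ker (coset N \o f).
  rewrite ker_coset; apply/subsetP=> z Nz; have Gz := subsetP sNG z Nz.
  have fz : f z \in N by apply: (subsetP fN); rewrite mem_morphim.
  apply/kerP; first by apply/morphpreP; rewrite (subsetP (normG N)).
  by rewrite /= coset_id.
have sG : G / N \subset coset N @* H0.
  rewrite morphimS //; apply/subsetP=> z Gz; apply/morphpreP; split=> //.
  apply: (subsetP nNsG).
  have fG : f @* G \subset G.
    rewrite -[X in f @* X]defG morphimMl ?cycle_subG // !morphim_cycle // fx fy.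
    by rewrite mul_subG ?cycle_subG.
  by apply: (subsetP fG); rewrite mem_morphim.
have H0P z : z \in G -> f z \in G -> z \in H0.
  by move=> Gz Gfz; apply/morphpreP; rewrite (subsetP nNsG).
apply: (isobicyclic_of_morphism (restrm_morphism sG (factm_morphism sK sH0G))).
- exact: coset_order.
- exact: coset_order.
- by rewrite -!quotient_cycle // -quotientMl ?cycle_subG // defG.
- apply/trivgP/subsetP=> _ /setIP[/cycleP[i ->] /cycleP[j e]].
  move: e; rewrite -!morphX // => /rcoset_kercosetP.
  move=> /(_ (groupX _ Nx) (groupX _ Ny)) /rcosetP[c Nc e].
  have /mulsgP[a b Xa Yb def_c] : c \in <[x ^+ m]> * <[y ^+ m]> by rewrite defN.
  have [ea _] : x ^+ i = a /\ 1 = b * y ^+ j.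
    apply: (TI_mulg_inj tiXY); rewrite ?mem_cycle ?group1 ?(subsetP sXX) //.
      by rewrite groupM ?mem_cycle ?(subsetP sYY).
    by rewrite mulg1 mulgA -def_c.
  rewrite ea; apply/set1P/coset_id.
  by rewrite -defN -[a]mulg1 mem_mulg ?group1.
- by rewrite /= /restrm factmE ?H0P ?fx //= fx.
- by rewrite /= /restrm factmE ?H0P ?fy //= fy.
Qed.

(* Wielandt's trick: a Hall subgroup containing <[x.`_pi]> contains a conjugate of
   <[y.`_pi]> by some b * a with b in <[y]> and a in <[x]>; conjugating back by a
   moves both cyclic groups into the same Hall subgroup. *)
Lemma isobicyclic_Hall {gT : finGroupType} {n : nat} (pi : nat_pred)
    {G : {group gT}} {x y : gT} :
  isobicyclic n G x y ->
  exists H : {group gT},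
    [/\ <[x.`_pi]> * <[y.`_pi]> = H, pi.-Hall(G) H
      & isobicyclic n`_pi H x.`_pi y.`_pi].
Proof.
move=> isoG; have [ox oy defG tiXY _] := isoG.
have [Gx Gy oG] := isobicyclic_gen isoG.
have solG := isobicyclic_solvable isoG.
have [||Q0 hallQ0 sXQ0] := Hall_superset (K := <[x.`_pi]>%G) (pi := pi) solG.
- by rewrite cycle_subG groupX.
- exact: p_elt_constt.
have [||g Gg sYQ0] := Hall_Jsub (H := Q0) (K := <[y.`_pi]>%G) solG hallQ0.
- by rewrite cycle_subG groupX.
- exact: p_elt_constt.
have : g \in <[y]> * <[x]>.
  have/comm_group_setP <- : group_set (<[x]> * <[y]>) by rewrite defG groupP.
  by rewrite defG.
case/mulsgP=> b a Yb Xa eg.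
have fixc (c d : gT) : d \in <[c]> -> <[c.`_pi]> :^ d = <[c.`_pi]>.
  move=> cd; apply/normP; apply: (subsetP (cent_sub _)); rewrite cent_cycle.
  by apply/cent1P; apply: (centsP (cycle_abelian c)); rewrite ?cycle_constt.
have Ga : a \in G by apply: subsetP Xa; rewrite cycle_subG.
pose Q := (Q0 :^ a^-1)%G.
have hallQ : pi.-Hall(G) Q by rewrite pHallJ ?groupV.
have sub : <[x.`_pi]> * <[y.`_pi]> \subset Q.
  apply: mul_subG; rewrite /= -sub_conjg; first by rewrite fixc.
  by move: sYQ0; rewrite eg conjsgM /= (fixc y b).
have ti : <[x.`_pi]> :&: <[y.`_pi]> = 1.
  by apply/trivgP; rewrite -tiXY setISS // cycle_subG cycle_constt.
have defQ : <[x.`_pi]> * <[y.`_pi]> = Q.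
  apply/eqP; rewrite eqEcard sub (card_Hall hallQ) TI_cardMg // -!orderE.
  have n_gt0 : (0 < n)%N by rewrite -ox order_gt0.
  rewrite !order_constt ox oy oG partnM //=.
exists Q; split=> //.
(* The exponent in [constt] depends only on the order, so the two parts are the same power of [x]
   and of [y]. *)
rewrite -ox -order_constt; rewrite /constt oy -ox.
by apply: (isobicyclic_sub isoG); rewrite -defQ /constt oy ox.
Qed.

(** * Normal subgroups of prime order *)

(** [K] is cyclic, so its subgroup of prime order [r] is characteristic in [K]; it is the only
    subgroup of order [r] in [<[x]>]. The swap carries it into [<[y]>]. *)
Lemma isobicyclic_normal_cyclic {gT : finGroupType} {n : nat} {G K : {group gT}}
    {x y : gT} :
  isobicyclic n G x y -> K :!=: 1 -> K \subset <[x]> -> K <| G ->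
  exists r : nat, [/\ prime r, (r %| n)%N, <[x ^+ (n %/ r)]> <| G
    & <[y ^+ (n %/ r)]> <| G].
Proof.
move=> isoG ntK sKX nKG; have [ox oy _ _ _] := isoG.
have [Gx Gy _] := isobicyclic_gen isoG.
have [f [_ fG fx fy]] := isobicyclic_swap isoG.
have cycX := cycle_cyclic x.
have K_gt1 : (1 < #|K|)%N by rewrite cardG_gt1.
have r_pr := pdiv_prime K_gt1; set r := pdiv #|K| in r_pr.
have [k Kk ok] := Cauchy r_pr (pdiv_dvd #|K|).
have dv_r_n : (r %| n)%N by rewrite -ox -ok order_dvdG ?(subsetP sKX).
have sxX : <[x ^+ (n %/ r)]> \subset <[x]> by rewrite cycle_subG mem_cycle.
have n_gt0 : (0 < n)%N by rewrite -ox order_gt0.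
have ek : <[x ^+ (n %/ r)]> = <[k]>.
  apply/eqP; rewrite (eq_subG_cyclic cycX) ?cycle_subG ?mem_cycle ?(subsetP sKX) //.
  rewrite -!orderE orderXdiv ox ?dvdn_div // ok.
  by rewrite divnA // mulKn.
have nx : <[x ^+ (n %/ r)]> <| G.
  apply: char_normal_trans nKG; rewrite sub_cyclic_char ?(cyclicS sKX) //.
  by rewrite /= ek cycle_subG.
exists r; split=> //.
have := morphim_normal f nx.
by rewrite fG morphim_cycle ?groupX // morphX // fx.
Qed.

(* If <[x]> and <[y]> contained no nontrivial normal subgroup of G, then
   'Z(<[x]> <*> G^`(1)) would be trivial, so <[x]>, of order n, would act faithfully
   on the abelian group G^`(1), of order at most n. *)
Lemma isobicyclic_core {gT : finGroupType} {n : nat} {G : {group gT}} {x y : gT} :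
  isobicyclic n G x y -> (1 < n)%N ->
  exists r : nat, [/\ prime r, (r %| n)%N, <[x ^+ (n %/ r)]> <| G
    & <[y ^+ (n %/ r)]> <| G].
Proof.
move=> isoG n_gt1; have [ox oy defG tiXY _] := isoG.
have [Gx Gy oG] := isobicyclic_gen isoG.
have cXX := cycle_abelian x; have cYY := cycle_abelian y.
have [sXG sYG] : <[x]> \subset G /\ <[y]> \subset G by rewrite !cycle_subG.
(* This centraliser commutes with both [<[x]>] and [<[y]>], so it is central in [G]; if nontrivial,
   it serves as [K] with [x] and [y] exchanged. *)
have [C1 | ntC] := eqVneq 'C_<[y]>(<[x]>) 1; last first.
  have [||r [r_pr dv ny nx]] := isobicyclic_normal_cyclic (isobicyclic_sym isoG) ntC.
  - exact: subsetIl.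
  - rewrite sub_center_normal // subsetI subIset ?sYG //= -defG centM.
    by rewrite subsetI subsetIr subIset // -abelianE cYY.
  by exists r.
have CX : 'C_G(<[x]>) = <[x]>.
  by rewrite -defG -group_modl ?C1 ?mulg1 // -abelianE.
pose M := G^`(1)%G; have cMM : abelian M := ito_der1_abelian cXX cYY defG.
have sMG : M \subset G := der_sub 1 G.
have nMX : <[x]> \subset 'N(M) by rewrite (subset_trans sXG) // der_norm.
pose L := (<[x]> <*> M)%G.
have nLG : L <| G.
  by rewrite sub_der1_normal ?joing_subr // join_subG sXG.
have sZX : 'Z(L) \subset <[x]>.
  rewrite -CX; apply/subsetP=> z /setIP[Lz cLz].
  rewrite inE (subsetP (normal_sub nLG)) //=.
  exact: subsetP (centS (joing_subl _ _)) _ cLz.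
have [Z1 | ntZ] := eqVneq 'Z(L) 1; last first.
  by apply: (isobicyclic_normal_cyclic isoG ntZ sZX); rewrite gFnormal_trans.
have CXM : 'C_<[x]>(M) = 1.
  apply/trivgP; rewrite -Z1; apply/subsetP=> z /setIP[Xz cMz].
  rewrite inE (subsetP (joing_subl _ _)) //= centY inE cMz andbT.
  exact: subsetP cXX _ Xz.
have [M1 | ntM] := eqVneq (M : {set gT}) 1.
  move: CXM; rewrite M1 cent1T setIT => X1.
  by move: n_gt1; rewrite -ox orderE X1 cards1.
have := card_cyclic_act_abelian (cycle_cyclic x) cMM nMX ntM.
rewrite CXM indexg1 -orderE ox ltnNge => /negP[].
(* The intersection centralises the abelian group [M], so faithfulness makes it trivial; counting
   then gives [#|M| <= n]. *)
have tiXM : <[x]> :&: M = 1.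
  by apply/trivgP; rewrite -CXM setIS // -abelianE.
have := subset_leq_card (mul_subG sXG sMG).
by rewrite TI_cardMg // -orderE ox oG leq_pmul2l // ltnW.
Qed.

(** * The Sylow subgroup for the largest prime *)

(** A nontrivial element of [A] has a [P]-orbit whose length is a power of [p] below [p], hence
    1. *)
Lemma pgroup_cent_small {gT : finGroupType} {p : nat} {P A : {group gT}} :
  prime p -> p.-group P -> P \subset 'N(A) -> (#|A| <= p)%N -> P \subset 'C(A).
Proof.
move=> p_pr pP nAP leAp; rewrite centsC; apply/subsetP=> e Ae.
have [-> | nte] := eqVneq e 1; first exact: group1.
have sub : e ^: P \subset A :\ 1.
  rewrite subsetD1 class_sub_norm // Ae.
  by apply/negP=> /imsetP[c _ /esym/eqP]; rewrite conjg_eq1 (negPf nte).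
have lt_p : (#|P : 'C_P[e]| < p)%N.
  rewrite index_cent1 (leq_trans _ leAp) // (cardsD1 1 A) group1.
  exact: subset_leq_card sub.
have : p.-nat #|P : 'C_P[e]| := pnat_dvd (dvdn_indexg _ _) pP.
case/p_natP=> k ek; move: lt_p; rewrite ek; case: k ek => [|k] ek.
  by move=> _; rewrite -sub_cent1 -indexg_eq1 -indexgI ek.
by rewrite ltnNge expnS leq_pmulr // expn_gt0 prime_gt0.
Qed.

(** Induction modulo [N] makes [P <*> N] normal. If [r = p], then [N] lies in [P]. Otherwise
    [r < p], so [P] centralises [N] and is characteristic in [P <*> N]. *)
Lemma isobicyclic_max_Sylow_normal {gT : finGroupType} {n p : nat}
    {G P : {group gT}} {x y : gT} :
  isobicyclic n G x y -> prime p ->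
  (forall r, prime r -> (r %| n)%N -> (r <= p)%N) -> p.-Sylow(G) P -> P <| G.
Proof.
have [k] := ubnP n; elim: k => // k IHk in gT n G P x y *.
rewrite ltnS => le_n_k isoG p_pr maxp sylP.
have [Gx Gy oG] := isobicyclic_gen isoG; have [ox oy _ _ _] := isoG.
have n_gt0 : (0 < n)%N by rewrite -ox order_gt0.
have sPG := pHall_sub sylP.
have [n1 | n_neq1] := eqVneq n 1%N.
  have G1 : G :=: 1 by apply: card1_trivg; rewrite oG n1.
  by have := sPG; rewrite G1 => /trivgP->; rewrite normal1.
have n_gt1 : (1 < n)%N by case: n n_gt0 n_neq1 {isoG oG maxp ox oy le_n_k} => [|[]].
have [r [r_pr dv_r_n nx ny]] := isobicyclic_core isoG n_gt1.
set m := (n %/ r)%N in nx ny.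
have m_lt_n : (m < n)%N by rewrite ltn_Pdiv ?prime_gt1.
pose N := (<[x ^+ m]> <*> <[y ^+ m]>)%G.
have defN : <[x ^+ m]> * <[y ^+ m]> = N.
  by rewrite /N /= norm_joinEr // (subset_trans _ (normal_norm nx)) // normal_sub.
have nNG : N <| G by rewrite normalY.
have isoGN := isobicyclic_quotient isoG (dvdn_div dv_r_n) nNG defN.
have nNsG := normal_norm nNG; have sNG := normal_sub nNG.
have nNP : P \subset 'N(N) by apply: subset_trans nNsG.
have nPNG : P / N <| G / N.
  apply: (IHk _ m (G / N)%G (P / N)%G _ _ _ isoGN p_pr); last exact: quotient_pHall.
    exact: leq_trans m_lt_n le_n_k.
  by move=> q q_pr dv_q_m; apply: maxp => //; rewrite (dvdn_trans dv_q_m) ?dvdn_div.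
have nPN : P <*> N <| G.
  by rewrite joingC norm_joinEr // -(quotientK nNP) -(quotientGK nNG) cosetpre_normal.
have oxm : #[x ^+ m] = r by rewrite orderXdiv ox ?dvdn_div // /m divnA // mulKn.
have oym : #[y ^+ m] = r by rewrite orderXdiv oy ?dvdn_div // /m divnA // mulKn.
have [eq_rp | neq_rp] := eqVneq r p.
  suffices sNP : N \subset P by rewrite (joing_idPl sNP) in nPN.
  rewrite -defN mul_subG //; apply: (subset_trans _ (pcore_sub_Hall sylP)).
    by rewrite pcore_max // /pgroup -orderE oxm eq_rp pnat_id.
  by rewrite pcore_max // /pgroup -orderE oym eq_rp pnat_id.
have lt_rp : (r < p)%N by rewrite ltn_neqAle neq_rp maxp.
have pP := pHall_pgroup sylP.
have cNP : P \subset 'C(N).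
  have cP z : #[z] = r -> <[z]> <| G -> P \subset 'C(<[z]>).
    move=> oz nz; apply: (pgroup_cent_small p_pr pP).
      exact: subset_trans (normal_norm nz).
    by rewrite -orderE oz ltnW.
  by rewrite centY subsetI !cP.
have sylPN : p.-Sylow(P <*> N) P.
  by apply: pHall_subl sylP; rewrite ?joing_subl ?normal_sub.
have nP : P <| P <*> N.
  rewrite /normal joing_subl join_subG normG /= centsC in cNP *.
  exact: subset_trans cNP (cent_sub P).
apply: char_normal_trans nPN.
by have := pcore_char p (P <*> N); rewrite /= (normal_Hall_pcore sylPN nP).
Qed.

(** * Action on a normal Sylow subgroup *)

Lemma expg_order_coprime {gT : finGroupType} {a : gT} {i k : nat} :
  a ^+ i = 1 -> a ^+ k = 1 -> coprime i k -> a = 1.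
Proof.
move=> ai ak co; apply/eqP; rewrite -order_eq1 -dvdn1 -(eqP co) dvdn_gcd.
by rewrite !order_dvdn ai ak eqxx.
Qed.

(** Since [c] commutes with [[~ t, c]], the power [[~ t, c] ^+ #[c]] equals [[~ t, c ^+ #[c]] =
    1]. *)
Lemma coprime_commg_eq1 {gT : finGroupType} {p : nat} {t c : gT} :
  commute c [~ t, c] -> [~ t, c] ^+ p = 1 -> coprime p #[c] -> [~ t, c] = 1.
Proof.
move=> cc ep; apply: expg_order_coprime ep _.
by rewrite -commgX // expg_order commg1.
Qed.

(** Induction modulo [N] gives the alternatives up to errors in [N]. If [r != p], then [N] meets [P]
    trivially and the errors vanish. If [r = p], then [N] is central in [P], and errors are absorbed
    in the exponent or killed by coprimality. The condition on [l.-1] says that [l] is not 1 modulo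
    [p]. *)
Lemma isobicyclic_Sylow_action {gT : finGroupType} {n p : nat}
    {G P : {group gT}} {x y : gT} :
  isobicyclic n G x y -> prime p -> P <| G -> p.-Sylow(G) P ->
  [~ y.`_p, x.`_p^'] = 1 \/
  [~ x.`_p, y.`_p] = 1 /\
  exists l : nat, [/\ (0 < l)%N, coprime l.-1 p & y.`_p ^ x.`_p^' = y.`_p ^+ l].
Proof.
have [k] := ubnP n; elim: k => // k IHk in gT n G P x y *.
rewrite ltnS => le_n_k isoG p_pr nPG sylP.
have [Gx Gy oG] := isobicyclic_gen isoG; have [ox oy defG tiXY _] := isoG.
have n_gt0 : (0 < n)%N by rewrite -ox order_gt0.
have [n1 | n_neq1] := eqVneq n 1%N.
  left; have -> : y = 1 by apply/eqP; rewrite -order_eq1 oy n1.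
  by rewrite constt1 comm1g.
have n_gt1 : (1 < n)%N by case: n n_gt0 n_neq1 {isoG oG ox oy le_n_k} => [|[]].
have [r [r_pr dv_r_n nx ny]] := isobicyclic_core isoG n_gt1.
set m := (n %/ r)%N in nx ny.
have m_lt_n : (m < n)%N by rewrite ltn_Pdiv ?prime_gt1.
pose N := (<[x ^+ m]> <*> <[y ^+ m]>)%G.
have defN : <[x ^+ m]> * <[y ^+ m]> = N.
  by rewrite /N /= norm_joinEr // (subset_trans _ (normal_norm nx)) // normal_sub.
have nNG : N <| G by rewrite normalY.
have isoGN := isobicyclic_quotient isoG (dvdn_div dv_r_n) nNG defN.
have nNsG := normal_norm nNG; have sNG := normal_sub nNG.
have sPG := pHall_sub sylP.
have IH := IHk _ m (G / N)%G (P / N)%G _ _ (leq_trans m_lt_n le_n_k) isoGN p_pr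
  (quotient_normal N nPG) (quotient_pHall (subset_trans sPG nNsG) sylP).
set u := x.`_p in IH *; set v := y.`_p in IH *; set z := x.`_p^' in IH *.
have [Gu Gv Gz] : [/\ u \in G, v \in G & z \in G] by split; apply: groupX.
have Pv : v \in P.
  by rewrite (mem_normal_Hall sylP) // p_elt_constt.
have Pu : u \in P.
  by rewrite (mem_normal_Hall sylP) // p_elt_constt.
have nPz : z \in 'N(P) := subsetP (normal_norm nPG) z Gz.
have Nn g : g \in G -> g \in 'N(N) by apply: (subsetP nNsG).
move: IH; rewrite -!morph_constt ?Nn // -/u -/v -/z -!morphR ?Nn // => IH.
have [f [_ _ fx fy]] := isobicyclic_swap isoG.
pose z' := y.`_p^'.
have [fu fv fz] : [/\ f u = v, f v = u & f z = z'].
  by rewrite /u /v /z /z' !morph_constt // fx fy.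
have [Xu Yv Xz Yz'] : [/\ u \in <[x]>, v \in <[y]>, z \in <[x]> & z' \in <[y]>].
  by rewrite !cycle_constt.
have [pu pv p'z p'z'] : [/\ p.-elt u, p.-elt v, p^'.-elt z & p^'.-elt z'].
  by rewrite !p_elt_constt.
have [ou ov] : #[u] = (n`_p)%N /\ #[v] = (n`_p)%N by rewrite !order_constt ox oy.
(* Both elements lie in a common Hall subgroup of order prime to [p], hence so does their
   commutator. *)
have p'zz' : p^'.-elt [~ z, z'].
  have [H [defH /pHall_pgroup p'H _]] := isobicyclic_Hall p^' isoG.
  apply: mem_p_elt p'H _; rewrite groupR // -defH.
    by rewrite -[z]mulg1 mem_mulg ?cycle_id ?group1.
  by rewrite -[z']mul1g mem_mulg ?cycle_id ?group1.
clearbody u v z z'.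
have oxm : #[x ^+ m] = r by rewrite orderXdiv ox ?dvdn_div // /m divnA // mulKn.
have oym : #[y ^+ m] = r by rewrite orderXdiv oy ?dvdn_div // /m divnA // mulKn.
have tiN : <[x ^+ m]> :&: <[y ^+ m]> = 1.
  by apply/trivgP; rewrite -tiXY setISS // cycle_subG mem_cycle.
have oN : #|N| = (r * r)%N by rewrite -defN TI_cardMg // -!orderE oxm oym.
have coset1 g : g \in G -> coset N g = 1 -> g \in N.
  by move=> Gg /coset_idr ->; rewrite ?Nn.
have IH' : [~ v, z] \in N \/ [~ u, v] \in N /\
    exists l, [/\ (0 < l)%N, coprime l.-1 p & v ^- l * v ^ z \in N].
  case: IH => [e | [e [l [l0 co el]]]]; first by left; apply: coset1; rewrite ?groupR.
  right; split; first by apply: coset1; rewrite ?groupR.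
  exists l; split=> //; apply: coset1; first by rewrite groupM ?groupV ?groupX ?groupJ.
  have [Nv Nz] : v \in 'N(N) /\ z \in 'N(N) by rewrite !Nn.
  by rewrite morphM ?groupV ?groupX ?groupJ // morphV ?groupX // morphX // morphJ // el mulVg.
have [eq_rp | neq_rp] := eqVneq r p; last first.
  have tiNP : N :&: P = 1.
    apply: coprime_TIg; rewrite oN coprimeMl andbb prime_coprime //.
    apply: contra neq_rp; rewrite -(dvdn_prime2 r_pr p_pr).
    by case/p_natP: (pHall_pgroup sylP) => e ->; rewrite Euclid_dvdX // => /andP[].
  have N1 g : g \in N -> g \in P -> g = 1.
    by move=> Ng Pg; apply/set1P; rewrite -[[set 1]]tiNP inE Ng.
  case: IH' => [e | [e [l [l0 co el]]]].
    by left; apply: N1; rewrite // commgEl groupM ?groupV ?memJ_norm.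
  right; split; first by apply: N1; rewrite // groupR.
  exists l; split=> //; apply: (mulgI (v ^- l)); rewrite mulVg.
  by apply: N1; rewrite // groupM ?groupV ?groupX ?memJ_norm.
move: r_pr dv_r_n @m nx ny m_lt_n @N defN nNG isoGN nNsG sNG Nn coset1 oN tiN oym oxm IH' IH.
rewrite {r}eq_rp => _ dv_p_n m nx ny m_lt_n N defN nNG _ nNsG sNG _ _ oN tiN oym oxm IH _.
have dv_p_v : (p %| #[v])%N by rewrite ov -{1}(part_pnat_id (pnat_id p_pr)) partn_dvd.
have p_gt0 := prime_gt0 p_pr; have p_gt1 := prime_gt1 p_pr.
(* With this exponent [u ^+ q] and [v ^+ q] generate the subgroups of order [p] of [<[x]>] and
   [<[y]>], that is, the two factors of [N]. *)
pose q := (#[v] %/ p)%N.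
have ovq : #[v ^+ q] = p by rewrite orderXdiv ?dvdn_div // /q divnA // mulKn ?order_gt0.
have ouq : #[u ^+ q] = p.
  by rewrite orderXdiv ou -ov ?dvdn_div // /q divnA // mulKn ?order_gt0.
have evq : <[v ^+ q]> = <[y ^+ m]>.
  apply/eqP; rewrite (eq_subG_cyclic (cycle_cyclic y)) ?cycle_subG ?mem_cycle ?groupX //.
  by rewrite -!orderE ovq oym.
have euq : <[u ^+ q]> = <[x ^+ m]>.
  apply/eqP; rewrite (eq_subG_cyclic (cycle_cyclic x)) ?cycle_subG ?mem_cycle ?groupX //.
  by rewrite -!orderE ouq oxm.
move: nx ny tiN defN; rewrite -euq -evq; clearbody N => {euq evq oxm oym}.
move=> nu nv tiN defN.
have pP := pHall_pgroup sylP.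
have central a b : #[a] = p -> <[a]> <| G -> b \in P -> commute a b.
  move=> oa na Pb; have Aa := cycle_id a.
  have: P \subset 'C(<[a]>).
    apply: (pgroup_cent_small p_pr pP); rewrite -?orderE ?oa //.
    exact: subset_trans sPG (normal_norm na).
  by move/subsetP/(_ b Pb)/centP/(_ a Aa)/commute_sym.
have NP a : a \in N -> exists i j, a = u ^+ q ^+ i * v ^+ q ^+ j.
  by rewrite -defN => /mulsgP[_ _ /cycleP[i ->] /cycleP[j ->] ->]; exists i, j.
have cqv b : b \in P -> commute (v ^+ q) b by apply: central.
have cqu b : b \in P -> commute (u ^+ q) b by apply: central.
have cN a b : a \in N -> b \in P -> commute a b.
  move=> /NP[i [j ->]] Pb; apply: commute_sym; apply: commuteM; apply: commuteX.
    exact/commute_sym/cqu.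
  exact/commute_sym/cqv.
have expN a : a \in N -> a ^+ p = 1.
  move=> /NP[i [j ->]]; rewrite expgMn; last first.
    by apply: commuteX2; apply: cqu; rewrite groupX.
  have exp1 b i' : #[b] = p -> b ^+ i' ^+ p = 1.
    by move=> ob; rewrite expgAC -ob expg_order expg1n.
  by rewrite !exp1 // mulg1.
have cuz : commute u z by apply: (centsP (cycle_abelian x)).
have cvz' : commute v z' by apply: (centsP (cycle_abelian y)).
have cxu i : (u ^+ i) ^ z = u ^+ i.
  by apply/conjg_fixP/commgP/commute_sym/commuteX/commute_sym.
have cxv i : (v ^+ i) ^ z' = v ^+ i.
  by apply/conjg_fixP/commgP/commute_sym/commuteX/commute_sym.
have copz : coprime p #[z] by apply: pnat_coprime p'z; rewrite pnat_id.
(* If [v] has order [p], then [<[v]>] is itself a factor of [N], so it is normal and [z] acts on it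
   by a power. *)
have [eqvp | neqvp] := eqVneq #[v] p.
  have q1 : q = 1%N by rewrite /q eqvp divnn p_gt0.
  have /cycleP[l el] : v ^ z \in <[v]>.
    move: nv; rewrite q1 expg1 => nv.
    by rewrite memJ_norm ?cycle_id // (subsetP (normal_norm nv)).
  have cuv : [~ u, v] = 1 by apply/eqP/commgP; have := cqu v Pv; rewrite q1.
  pose l' := (l %% p)%N.
  have el' : v ^ z = v ^+ l' by rewrite el /l' -eqvp expg_mod_order.
  have l'p : (l' < p)%N by rewrite ltn_mod.
  case: (ltngtP l' 1) => [| l1 | l1].
  - rewrite ltnS leqn0 => /eqP l0; move/eqP: el'; rewrite l0 conjg_eq1 => /eqP v1.
    by left; rewrite v1 comm1g.
  - right; split=> //; exists l'; rewrite (ltnW l1); split=> //.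
    rewrite coprime_sym prime_coprime // gtnNdvd ?(leq_ltn_trans (leq_pred _)) //.
    by rewrite -ltnS prednK // ltnW.
  - by left; apply/eqP; apply/conjg_fixP; rewrite el' l1.
(* From here on, [q]-th powers kill [N], so the action on [v ^+ q] is known without error. *)
have dv_p_q : (p %| q)%N.
  have : p.-nat q by apply: pnat_dvd pv; apply: dvdn_div.
  case/p_natP=> e ee; move: neqvp; rewrite -(divnK dv_p_v) -/q ee.
  by case: e ee => [|e] _; rewrite ?mul1n ?eqxx // expnS dvdn_mulr.
have expNq a : a \in N -> a ^+ q = 1.
  by move=> Na; rewrite -(divnK dv_p_q) mulnC expgM expN // expg1n.
have Nvq i : v ^+ q ^+ i \in N.
  by rewrite -defN -[_ ^+ i]mul1g mem_mulg ?group1 ?mem_cycle.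
have Nuq i : u ^+ q ^+ i \in N.
  by rewrite -defN -[_ ^+ i]mulg1 mem_mulg ?group1 ?mem_cycle.
case: IH => [Ne | [Nw [l [l0 co Nl]]]].
  (* Here [z] fixes [u ^+ q] and [v ^+ q], hence centralises [N], which contains [[~ v, z]]. *)
  left; apply: (@coprime_commg_eq1 _ p) => //; last exact: expN.
  have vqz : (v ^+ q) ^ z = v ^+ q.
    have ev : v ^ z = v * [~ v, z] by rewrite commgEl mulKVg.
    have cve : commute v [~ v, z] by apply/commute_sym/cN.
    by rewrite conjXg ev expgMn // (expNq _ Ne) mulg1.
  case: (NP _ Ne) => i [j ->].
  apply: commuteM; last by apply: commuteX; apply/commute_sym/commgP/conjg_fixP.
  by do 2!apply: commuteX; apply: commute_sym.
right.
have sNP a : a \in N -> a \in P.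
  by case/NP=> i [j ->]; rewrite groupM ?groupX.
set nu' := v ^- l * v ^ z in Nl.
have ev : v ^ z = v ^+ l * nu' by rewrite /nu' mulKVg.
have vqz : (v ^+ q) ^ z = v ^+ q ^+ l.
  rewrite conjXg ev expgMn; last by apply/commute_sym/cN; rewrite ?groupX.
  by rewrite (expNq _ Nl) mulg1 expgAC.
have uqz' : (u ^+ q) ^ z' = u ^+ q ^+ l.
  have := congr1 f vqz.
  by rewrite morphJ ?groupX // !morphX ?groupX // fv fz.
have eqX_l (a : gT) : a ^+ p = 1 -> a ^+ l = a -> a = 1.
  move=> ap e; apply: (expg_order_coprime _ ap co).
  by apply: (mulIg a); rewrite -expgSr prednK // e mul1g.
(* On N, z has the eigenvectors u ^+ q and v ^+ q with eigenvalues 1 and l; it scales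
   w := [~ u, v] by l, so w lies in <[v ^+ q]>, and in <[u ^+ q]> by symmetry. *)
have cuv : [~ u, v] = 1.
  set w := [~ u, v] in Nw *.
  have wz : w ^ z = w ^+ l.
    rewrite conjRg ev -{1}[u]expg1 cxu expg1 commgMJ.
    have -> : [~ u, nu'] = 1 by apply/eqP/commgP/commute_sym/cN.
    rewrite mul1g commgX; last by apply/commute_sym/cN.
    by apply/conjg_fixP/commgP/commute_sym; apply: cN; rewrite ?groupX ?sNP.
  have [i [j ew]] := NP _ Nw.
  have ewl : u ^+ q ^+ i * v ^+ q ^+ j ^+ l = u ^+ q ^+ i ^+ l * v ^+ q ^+ j ^+ l.
    rewrite -expgMn -?ew; last by apply: commuteX2; apply: cqu; rewrite groupX.
    by rewrite -wz ew conjMg -expgM cxu expgM conjXg vqz [v ^+ q ^+ l ^+ j]expgAC.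
  have ei := eqX_l _ (expN _ (Nuq i)) (esym (mulIg _ _ _ ewl)).
  rewrite ei mul1g in ew.
  have fw : w^-1 = u ^+ q ^+ j.
    have := congr1 f ew; rewrite morphR // fu fv !morphX ?groupX // fv => <-.
    by rewrite invg_comm.
  apply/set1P; rewrite -[[set 1]]tiN inE -groupV fw mem_cycle /= ew.
  exact: mem_cycle.
split=> //.
have [i [j enu]] := NP _ Nl.
(* The component of the error along [v] goes into the exponent [l + q * j], which is [l] modulo [p];
   only [al] remains to be eliminated. *)
pose al := u ^+ q ^+ i; have Nal : al \in N by apply: Nuq.
have et : v ^ z = v ^+ (l + q * j) * al.
  rewrite ev enu -/al (cN al (v ^+ q ^+ j) Nal) ?sNP //.
  by rewrite expgnDr expgM mulgA.
have alz' : al ^ z' = al ^+ l by rewrite /al conjXg uqz' expgAC.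
suffices al1 : al = 1.
  exists (l + q * j)%N; rewrite et al1 mulg1 addn_gt0 l0; split=> //.
  have -> : (l + q * j).-1 = (q * j %/ p * p + l.-1)%N.
    by rewrite divnK ?dvdn_mulr //; case: (l) l0 => // l1 _; rewrite addSn addnC.
  by rewrite -coprime_modl modnMDl coprime_modl.
apply: (eqX_l _ (expN _ Nal)).
(* The commutator c of z and z' has order prime to p and acts trivially on N, while
   it moves v ^ z by an element of N; hence it fixes v ^ z. *)
pose c := [~ z, z'].
have ezc : z * z' = z' * z * c by rewrite /c -commgC.
have Nc a : a \in N -> a ^ (z * z') = a ^ (z' * z).
  have eu : (u ^+ q) ^ (z * z') = (u ^+ q) ^ (z' * z).
    by rewrite !conjgM cxu uqz' -expgM cxu.
  have ew : (v ^+ q) ^ (z * z') = (v ^+ q) ^ (z' * z).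
    by rewrite !conjgM cxv vqz -expgM cxv.
  by case/NP=> i1 [j1 ->]; rewrite !conjMg !(conjXg (_ ^+ q)) eu ew.
have Gz' : z' \in G by apply: subsetP Yz'; rewrite cycle_subG.
have cc a : a \in N -> commute c a.
  move=> Na; apply/commute_sym/commgP/conjg_fixP.
  have Nb : a ^ (z' * z)^-1 \in N by rewrite memJ_norm // (subsetP nNsG) // groupV groupM.
  by rewrite -{1}[a](conjgKV (z' * z)) -conjgM -ezc Nc // conjgKV.
(* As [z'] fixes [v], conjugating [v ^ z] by [c] or by [z'] has the same effect, and [z'] changes
   only the factor [al]. *)
have etc : [~ v ^ z, c] = al^-1 * al ^+ l.
  have vzc : (v ^ z) ^ c = (v ^ z) ^ z'.
    by rewrite -[RHS]conjgM ezc !conjgM [v ^ z'](cxv 1%N).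
  by rewrite commgEl vzc et conjMg cxv alz' invMg mulgA mulgKV.
have Nalc : al^-1 * al ^+ l \in N := groupM (groupVr Nal) (groupX l Nal).
have := @coprime_commg_eq1 _ p (v ^ z) c.
rewrite etc => e; apply: (mulgI al^-1); rewrite mulVg.
apply: e (cc _ Nalc) (expN _ Nalc) _.
by rewrite (@pnat_coprime p) ?pnat_id.
Qed.

(** * Internal semidirect decomposition *)

Lemma coprime_sdprod {gT : finGroupType} {T S G : {group gT}} :
  T \subset G -> S \subset G -> S \subset 'N(T) -> coprime #|T| #|S| ->
  (#|T| * #|S|)%N = #|G| -> T ><| S = G.
Proof.
move=> sTG sSG nTS co oG; have ti := coprime_TIg co.
rewrite sdprodE //; apply/eqP.
by rewrite eqEcard mul_subG //= TI_cardMg // oG.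
Qed.

Lemma isobicyclic_mul_cycles {gT : finGroupType} {n i : nat} {G K : {group gT}} {x y : gT} :
  isobicyclic n G x y -> x ^+ i \in K -> y ^+ i \in K ->
  #|K| = (#[x ^+ i] * #[x ^+ i])%N -> <[x ^+ i]> * <[y ^+ i]> = K.
Proof.
case=> ox oy _ tiXY _ Kx Ky oK; apply/eqP.
rewrite eqEcard mul_subG ?cycle_subG //= TI_cardMg.
  by rewrite -!orderE oK !orderXgcd ox oy.
by apply/trivgP; rewrite -tiXY setISS // cycle_subG mem_cycle.
Qed.

(** The components of [x] and [y] are powers with common exponents, so the swap exchanges them and
    one action formula yields the other. The condition on [l.-1] strengthens the induction: it is
    what makes [T] centralise the next Sylow subgroup when that one joins [T]. *)
Lemma isobicyclic_decomposition {gT : finGroupType} {n : nat} {G : {group gT}} {x y : gT} :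
  isobicyclic n G x y ->
  exists (s t i j l : nat) (T S : {group gT}),
    [/\ n = (s * t)%N, coprime s t, T ><| S = G, x = x ^+ i * x ^+ j
      & y = y ^+ i * y ^+ j] /\
    [/\ <[x ^+ i]> * <[y ^+ i]> = S, #[x ^+ i] = s, nilpotent S,
        <[x ^+ j]> \x <[y ^+ j]> = T & #[x ^+ j] = t] /\
    [/\ (0 < l)%N, coprime l t, coprime l.-1 t
      & (y ^+ j) ^ (x ^+ i) = y ^+ j ^+ l].
Proof.
have [k] := ubnP n; elim: k => // k IHk in n G x y *.
rewrite ltnS => le_n_k isoG; have [ox oy defG tiXY _] := isoG.
have [Gx Gy oG] := isobicyclic_gen isoG.
have n_gt0 : (0 < n)%N by rewrite -ox order_gt0.
have [n1 | n_neq1] := eqVneq n 1%N.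
  have [x1 y1] : x = 1 /\ y = 1 by split; apply/eqP; rewrite -order_eq1 ?ox ?oy n1.
  have G1 : G :=: 1 by rewrite -defG x1 y1 cycle1 mulg1.
  (* For [t = 1] the eigenvalue 1 is admissible, as 0 is coprime to 1. *)
  exists 1%N, 1%N, 0%N, 0%N, 1%N, 1%G, 1%G.
  rewrite !expg0 x1 y1 n1 G1 sdprodg1 mulg1 cycle1 dprodg1 mulg1 order1.
  by rewrite conj1g expg1n nilpotent1.
have n_gt1 : (1 < n)%N by case: n n_gt0 n_neq1 {isoG oG ox oy le_n_k} => [|[]].
pose p := max_pdiv n; have p_pr : prime p := max_pdiv_prime n_gt1.
have [P [defP sylP _]] := isobicyclic_Hall p isoG.
have [H [defH hallH isoH]] := isobicyclic_Hall p^' isoG.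
have nPG : P <| G.
  apply: (isobicyclic_max_Sylow_normal isoG p_pr _ sylP) => r r_pr dv_r_n.
  by apply: max_pdiv_max; rewrite mem_primes r_pr n_gt0.
have act := isobicyclic_Sylow_action isoG p_pr nPG sylP.
have [b [eu ev]] : exists b, x.`_p = x ^+ b /\ y.`_p = y ^+ b.
  by rewrite /constt ox oy; eexists.
have [a [ez ew]] : exists a, x.`_p^' = x ^+ a /\ y.`_p^' = y ^+ a.
  by rewrite /constt ox oy; eexists.
have [f [_ _ fx fy]] := isobicyclic_swap isoG.
set m := (n`_p^')%N in isoH.
have m_lt_n : (m < n)%N.
  rewrite -[X in (_ < X)%N](partnC p n_gt0) -/m ltn_Pmull ?part_gt0 //.
  by rewrite p_part -(expn0 p) ltn_exp2l ?prime_gt1 // logn_gt0 mem_primes p_pr n_gt0 max_pdiv_dvd.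
have [s [t [i [j [l [T [S [[def_m co_st defTS def_z def_w]]]]]]]]] :=
  IHk _ _ _ _ (leq_trans m_lt_n le_n_k) isoH.
case=> [[defS oS nilS defT oT] [l_gt0 co_l co_l1 actST]].
have ux : x.`_p * x.`_p^' = x := consttC p x.
have vy : y.`_p * y.`_p^' = y := consttC p y.
have ou : #[x.`_p] = (n`_p)%N by rewrite order_constt ox.
have ov : #[y.`_p] = (n`_p)%N by rewrite order_constt oy.
set u := x.`_p in eu act defP ux ou *; set v := y.`_p in ev act defP vy ov *.
set z := x.`_p^' in ez act isoH defH def_z oS oT defS defT actST ux *.
set w := y.`_p^' in ew act isoH defH def_w defS defT actST vy *.
have [Gu Gv Gz Gw] : [/\ u \in G, v \in G, z \in G & w \in G].
  by split; apply: groupX.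
have [fu fv fz fw] : [/\ f u = v, f v = u, f z = w & f w = z].
  by rewrite eu ev ez ew !morphX // fx fy.
clearbody u v z w.
have [Pu Pv] : u \in P /\ v \in P.
  by rewrite -defP -{1}[u]mulg1 -{2}[v]mul1g !mem_mulg ?cycle_id ?group1.
have [Hz Hw] : z \in H /\ w \in H.
  by rewrite -defH -{1}[z]mulg1 -{2}[w]mul1g !mem_mulg ?cycle_id ?group1.
have [oz ow] : #[z] = m /\ #[w] = m by case: isoH.
have owj : #[w ^+ j] = t by rewrite -oT !orderXgcd oz ow.
have tiX c d : <[x ^+ c]> :&: <[y ^+ d]> = 1.
  by apply/trivgP; rewrite -tiXY setISS // cycle_subG mem_cycle.
have [sTH sSH] : T \subset H /\ S \subset H.
  by case/sdprodP: defTS => _ <- _ _; rewrite mulG_subl mulG_subr.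
have nTS : S \subset 'N(T) by case/sdprodP: defTS.
have [Szi Swi] : z ^+ i \in S /\ w ^+ i \in S.
  by rewrite -defS -{1}[z ^+ i]mulg1 -{2}[w ^+ i]mul1g !mem_mulg ?cycle_id ?group1.
have [Tzj Twj] : z ^+ j \in T /\ w ^+ j \in T.
  case/dprodP: defT => _ <- _ _.
  by rewrite -{1}[z ^+ j]mulg1 -{2}[w ^+ j]mul1g !mem_mulg ?cycle_id ?group1.
have sPG := normal_sub nPG; have sHG := pHall_sub hallH.
have oP : #|P| = (n`_p * n`_p)%N by rewrite (card_Hall sylP) oG partnM.
have owi : #[w ^+ i] = s by rewrite -oS !orderXgcd oz ow.
have oSS : #|S| = (s * s)%N.
  rewrite -defS TI_cardMg -?orderE ?oS ?owi //.
  by rewrite ez ew -!expgM tiX.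
have oTT : #|T| = (t * t)%N by rewrite -(dprod_card defT) -!orderE oT owj.
have def_n : n = (n`_p * (s * t))%N by rewrite -def_m partnC.
have co_pm : coprime n`_p (s * t) by rewrite -def_m coprime_partC.
move: (co_pm); rewrite coprimeMr => /andP[co_ps co_pt].
have cxx c d : commute (x ^+ c) (x ^+ d) by apply: commuteX2.
have cyy c d : commute (y ^+ c) (y ^+ d) by apply: commuteX2.
case: act => [cvz | [cuv [l' [l'_gt0 co_l'1 actv]]]].
(* Here [H] centralises [P], so [P] joins [S], and the new component of [x] in [S] is
   [u * z ^+ i]. *)
- have cvz' : commute v z by apply/commgP/eqP.
  have cuw : commute u w.
    by apply/commgP/eqP; rewrite -[RHS](morph1 f) -cvz morphR // fv fz.
  have cPH : H \subset 'C(P).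
    rewrite -defP -defH centM; apply: mul_subG; rewrite cycle_subG in_setI /= !cent_cycle.
      by apply/andP; split; apply/cent1P => //; rewrite ez eu.
    by apply/andP; split; apply/cent1P => //; rewrite ew ev.
  have tiPS : P :&: S = 1 by apply: coprime_TIg; rewrite oP oSS !coprimeMl !coprimeMr co_ps.
  have defPS : P \x S = P <*> S by rewrite dprodEY // (subset_trans sSH).
  have oPS : #|P <*> S| = (n`_p * s * (n`_p * s))%N.
    by rewrite -(dprod_card defPS) oP oSS mulnACA.
  have oxi : #[x ^+ (b + a * i)] = (n`_p * s)%N.
    have cuzi : commute u (z ^+ i) by rewrite eu ez -expgM.
    by rewrite expgnDr expgM -eu -ez orderM ?ou ?oS.
  have [exi exj] : x ^+ (b + a * i) = u * z ^+ i /\ x ^+ (a * j) = z ^+ j.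
    by rewrite expgnDr !expgM eu ez.
  have [eyi eyj] : y ^+ (b + a * i) = v * w ^+ i /\ y ^+ (a * j) = w ^+ j.
    by rewrite expgnDr !expgM ev ew.
  exists (n`_p * s)%N, t, (b + a * i)%N, (a * j)%N, l, T, (P <*> S)%G.
  split; [split | split; split => //].
  + by rewrite -mulnA.
  + by rewrite coprimeMl co_pt.
  + apply: coprime_sdprod.
    * exact: subset_trans sHG.
    * by rewrite join_subG sPG (subset_trans sSH).
    * rewrite join_subG nTS andbT (subset_trans _ (cent_sub T)) //.
      by rewrite centsC (subset_trans sTH).
    * by rewrite oTT oPS !(coprimeMl, coprimeMr) !(coprime_sym t) co_pt co_st.
    * by rewrite oTT oPS oG mulnACA [(t * (n`_p * s))%N]mulnC -[(n`_p * s * t)%N]mulnA -def_n.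
  + by rewrite exi exj -mulgA -def_z ux.
  + by rewrite eyi eyj -mulgA -def_w vy.
  + apply: (isobicyclic_mul_cycles isoG); rewrite ?exi ?eyi.
    * by rewrite groupM ?(subsetP (joing_subl _ _) _ Pu) ?(subsetP (joing_subr _ _) _ Szi).
    * by rewrite groupM ?(subsetP (joing_subl _ _) _ Pv) ?(subsetP (joing_subr _ _) _ Swi).
    * by rewrite -exi oxi oPS.
  + by rewrite (dprod_nil defPS) nilS (pgroup_nil (pHall_pgroup sylP)).
  + by rewrite exj eyj.
  + by rewrite exj.
  + rewrite eyj exi conjgM -actST; congr (_ ^ _).
    by apply/conjg_fixP/commgP/commute_sym/commuteX.
have cuv' : commute u v by apply/commgP/eqP.
have cuz : commute u z by rewrite eu ez.
have cvw : commute v w by rewrite ev ew.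
have czij : commute (z ^+ i) (z ^+ j) by apply: commuteX2.
have actu : u ^ w = u ^+ l' by rewrite -fv -fz -morphJ // actv morphX // fv.
have nuw c : u ^ (w ^+ c) \in <[u]>.
  rewrite memJ_norm ?cycle_id // groupX // -cycle_subG norms_cycle actu.
  exact: mem_cycle.
(* z ^+ i fixes both u and u ^ (w ^+ j), but raises w ^+ j to the power l; hence
   w ^+ j ^+ l.-1, which generates <[w ^+ j]>, commutes with u. *)
have cuwj : commute u (w ^+ j).
  have e : u ^ (w ^+ j) = u ^ (w ^+ j ^+ l).
    have <- : (u ^ (w ^+ j)) ^ (z ^+ i) = u ^ (w ^+ j).
      have /cycleP[c ->] := nuw j.
      by apply/conjg_fixP/commgP/commute_sym/commuteX/commute_sym/commuteX.
    rewrite conjJg actST; congr (_ ^ _).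
    exact/conjg_fixP/commgP/commuteX.
  have cl1 : commute u (w ^+ j ^+ l.-1).
    apply/commgP/conjg_fixP; apply: (conjg_inj (w ^+ j)).
    by rewrite -conjgM -expgSr prednK.
  have /cycleP[c ->] : w ^+ j \in <[w ^+ j ^+ l.-1]>.
    have : generator <[w ^+ j]> (w ^+ j ^+ l.-1).
      by rewrite generator_coprime owj coprime_sym.
    by move/eqP=> <-; apply: cycle_id.
  exact: commuteX.
have cvzj : commute v (z ^+ j).
  apply/commgP/eqP; rewrite -fu -fw -morphX // -morphR ?groupX //.
  by rewrite (eqP (introT commgP cuwj)) morph1.
have cuzj : commute u (z ^+ j) by apply: commuteX.
have cvwj : commute v (w ^+ j) by apply: commuteX.
have cPT : T \subset 'C(P).
  case/dprodP: defT => _ <- _ _.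
  rewrite -defP centM; apply: mul_subG; rewrite cycle_subG in_setI /= !cent_cycle.
    by apply/andP; split; apply/cent1P.
  by apply/andP; split; apply/cent1P.
have tiPT : P :&: T = 1 by apply: coprime_TIg; rewrite oP oTT !coprimeMl !coprimeMr co_pt.
have defPT : P \x T = P <*> T by rewrite dprodEY.
have oPT : #|P <*> T| = (n`_p * t * (n`_p * t))%N.
  by rewrite -(dprod_card defPT) oP oTT mulnACA.
have [exi exj] : x ^+ (a * i) = z ^+ i /\ x ^+ (b + a * j) = u * z ^+ j.
  by rewrite expgnDr !expgM eu ez.
have [eyi eyj] : y ^+ (a * i) = w ^+ i /\ y ^+ (b + a * j) = v * w ^+ j.
  by rewrite expgnDr !expgM ev ew.
have oxj : #[x ^+ (b + a * j)] = (n`_p * t)%N.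
  by rewrite exj orderM ?ou ?oT.
(* Since [z ^+ j] commutes with [v], the factor [z ^+ i] acts on [v] as all of [z] does. *)
have defv : v ^ (z ^+ i) = v ^+ l'.
  have fixv : v ^ (z ^+ j) = v by apply/conjg_fixP/commgP.
  by rewrite -actv [in RHS]def_z czij conjgM fixv.
(* The common eigenvalue is [l'] modulo the [p]-part of [n] and [l] modulo [t]. The added multiple
   makes it positive, so that its predecessor is a true difference. *)
pose lam := (chinese n`_p t l' l + n`_p * t)%N.
have lam_p : lam = l' %[mod n`_p] by rewrite /lam addnC mulnC modnMDl chinese_modl.
have lam_t : lam = l %[mod t] by rewrite /lam addnC modnMDl chinese_modr.
have np_gt0 : (0 < n`_p)%N by apply: part_gt0.
have t_gt0 : (0 < t)%N by rewrite -oT.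
have lam_gt0 : (0 < lam)%N by rewrite addn_gt0 muln_gt0 np_gt0 t_gt0 orbT.
clearbody lam.
have pred_mod c d e : (0 < c)%N -> (0 < d)%N -> c = d %[mod e] -> c.-1 = d.-1 %[mod e].
  by case: c d => [|c] [|d] // _ _ /eqP e0; apply/eqP; rewrite -(eqn_modDr 1) !addn1.
(* Conjugation preserves orders, so [v ^+ l'] still generates [<[v]>]. *)
have co_l'_p : coprime l' n`_p.
  rewrite coprime_sym -ov -generator_coprime /generator eq_sym.
  by rewrite eqEcard cycle_subG mem_cycle -actv -!orderE orderJ /=.
have vlam : v ^+ lam = v ^+ l'.
  by rewrite -(expg_mod_order v lam) ov lam_p -ov expg_mod_order.
have wlam : w ^+ j ^+ lam = w ^+ j ^+ l.
  by rewrite -(expg_mod_order _ lam) owj lam_t -owj expg_mod_order.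
exists s, (n`_p * t)%N, (a * i)%N, (b + a * j)%N, lam, (P <*> T)%G, S.
split; [split | split; split => //].
- by rewrite mulnCA.
- by rewrite coprimeMr coprime_sym co_ps.
- apply: coprime_sdprod.
  + by rewrite join_subG sPG (subset_trans sTH).
  + exact: subset_trans sHG.
  + by rewrite normsY // (subset_trans sSH) // (subset_trans sHG) // normal_norm.
  + by rewrite oPT oSS !(coprimeMl, coprimeMr) co_ps coprime_sym co_st.
  + by rewrite oPT oSS oG mulnACA -[(n`_p * t * s)%N]mulnA [(t * s)%N]mulnC -def_n.
- by rewrite exi exj mulgA -(commuteX i cuz) -mulgA -def_z ux.
- by rewrite eyi eyj mulgA -(commuteX i cvw) -mulgA -def_w vy.
- by rewrite exi eyi.
- by rewrite exi.
- rewrite dprodE.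
  + apply: (isobicyclic_mul_cycles isoG); last by rewrite oxj oPT.
      by rewrite exj groupM ?(subsetP (joing_subl _ _) _ Pu) ?(subsetP (joing_subr _ _) _ Tzj).
    by rewrite eyj groupM ?(subsetP (joing_subl _ _) _ Pv) ?(subsetP (joing_subr _ _) _ Twj).
  + rewrite exj eyj cycle_subG /= cent_cycle; apply/cent1P.
    have czw : commute (z ^+ j) (w ^+ j).
      case/dprodP: defT => _ _ /centsP cyx _.
      by apply/commute_sym/cyx; apply: cycle_id.
    apply: commuteM; apply: commute_sym; apply: commuteM => //;
      exact: commute_sym.
  + exact: tiX.
- by rewrite coprimeMr -(coprime_modl lam) lam_p coprime_modl co_l'_p -coprime_modl lam_t coprime_modl.
- rewrite coprimeMr; apply/andP; split.
    rewrite -coprime_modl (pred_mod _ _ _ lam_gt0 l'_gt0 lam_p) coprime_modl.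
    by rewrite p_part coprimeXr.
  by rewrite -coprime_modl (pred_mod _ _ _ lam_gt0 l_gt0 lam_t) coprime_modl.
- by rewrite eyj exi conjMg defv actST expgMn // vlam wlam.
Qed.

(** * Standard triples and cartesian products *)

(** This is the inverse of the wanted isomorphism: exponents are read off the ordinals of the
    standard group, whose modulus [t.-1.+1] is [t] for positive [t]. *)
Definition std_map {gT : finGroupType} (t : nat) (x y : gT) (c : Cyc t * Cyc t) : gT :=
  x ^+ (c.1 : 'I_t.-1.+1) * y ^+ (c.2 : 'I_t.-1.+1).

Lemma std_map_morphM {gT : finGroupType} {t : nat} {x y : gT} :
  (0 < t)%N -> #[x] = t -> #[y] = t -> commute x y ->
  {in stdT t &, {morph std_map t x y : c d / c * d}}.
Proof.
move=> t_gt0 ox oy cxy [c1 c2] [d1 d2] _ _; rewrite /std_map /=.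
have modX (z : gT) k : #[z] = t -> z ^+ (k %% t.-1.+1)%N = z ^+ k.
  by move=> oz; rewrite prednK // -oz expg_mod_order.
rewrite !modX // !expgnDr -!mulgA; congr (_ * _); rewrite !mulgA; congr (_ * _).
exact: commuteX2.
Qed.

Lemma homocyclic_triple_iso {gT : finGroupType} {t : nat} {T : {group gT}} {x y : gT} :
  #[x] = t -> #[y] = t -> <[x]> \x <[y]> = T ->
  triple_iso T x y (stdT t) (std_x t) (std_y t).
Proof.
move=> ox oy defT; have t_gt0 : (0 < t)%N by rewrite -ox order_gt0.
have [_ defT' cYX tiXY] := dprodP defT.
have cxy : commute x y.
  by apply/commute_sym/(centsP cYX); apply: cycle_id.
pose g := Morphism (std_map_morphM t_gt0 ox oy cxy).
have injg : 'injm g.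
  apply/subsetP=> [[c d]] /kerP => /(_ (in_setT _)); rewrite /= /std_map /= => e.
  have [ec ed] : x ^+ (c : 'I_t.-1.+1) = 1 /\ y ^+ (d : 'I_t.-1.+1) = 1.
    by apply: (TI_mulg_inj tiXY); rewrite ?mem_cycle ?group1 // e mulg1.
  have small (z : gT) (k : 'I_t.-1.+1) : #[z] = t -> z ^+ k = 1 -> k = 0%N :> nat.
    move=> oz /eqP; rewrite -order_dvdn oz => dv; apply/eqP; rewrite -leqn0 leqNgt.
    by apply/negP=> /dvdn_leq /(_ dv); rewrite leqNgt -{2}(prednK t_gt0) ltn_ord.
  by apply/set1P; congr (_, _); apply: val_inj; [apply: (small x) | apply: (small y)].
(* The generator [Zp1] has value [1 %% t.-1.+1], which is 0 when [t = 1]; then [z] is trivial. *)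
have expg_1t (z : gT) : #[z] = t -> z ^+ (1 %% t.-1.+1)%N = z.
  by move=> oz; rewrite prednK // -oz expg_mod_order.
have gx : g (std_x t) = x by rewrite /= /std_map /= expg0 mulg1 expg_1t.
have gy : g (std_y t) = y by rewrite /= /std_map /= expg0 mul1g expg_1t.
have eT : (g @* stdT t)%G = T.
  apply/val_inj => /=; apply/eqP; rewrite eqEcard; apply/andP; split.
    apply/subsetP=> _ /morphimP[c _ _ ->]; rewrite -defT'.
    by rewrite mem_mulg ?mem_cycle.
  rewrite card_injm // -(dprod_card defT) -!orderE ox oy.
  by rewrite cardsT card_prod card_ord prednK.
rewrite -eT; exists (invm_morphism injg); split.
- by apply/isomP; rewrite injm_invm im_invm.
- by have := invmE injg (in_setT (std_x t)); rewrite gx.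
- by have := invmE injg (in_setT (std_y t)); rewrite gy.
Qed.

(** [prod_constt] ranges over all naturals up to the order; the constituents at indices outside
    [primes n] are trivial. *)
Lemma prod_constt_primes {gT : finGroupType} {n : nat} {x : gT} :
  #[x] = n -> \prod_(p <- primes n) x.`_p = x.
Proof.
move=> ox; have n_gt0 : (0 < n)%N by rewrite -ox order_gt0.
have -> : primes n = [seq p <- index_iota 0 n.+1 | p \in primes n].
  apply: (irr_sorted_eq ltn_trans ltnn); rewrite ?sorted_primes //.
    by rewrite (sorted_filter ltn_trans) // iota_ltn_sorted.
  move=> p; rewrite mem_filter mem_index_iota /= ltnS.
  by case: (boolP (p \in primes n)) => //; rewrite mem_primes => /and3P[_ _ /dvdn_leq->].
rewrite big_filter big_mkcond -[RHS]prod_constt ox; apply: eq_bigr => p _.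
case: ifP => // /negbT p'n; apply/esym/constt1P; rewrite /p_elt ox.
by apply/pnatP=> // q q_pr dv_q; apply: contra p'n => /eqnP <-; rewrite mem_primes q_pr n_gt0.
Qed.

(** Nilpotency identifies the Sylow subgroups supplied by [isobicyclic_Hall] with the cores of [S],
    whose direct product is [S]. *)
Lemma nilpotent_isobicyclic_cart_prod {gT : finGroupType} {s : nat} {S : {group gT}}
    {x y : gT} :
  isobicyclic s S x y -> nilpotent S ->
  exists (k : nat) (p e : 'I_k -> nat) (Si : 'I_k -> {group gT}) (xi yi : 'I_k -> gT),
    [/\ [/\ injective p, forall i, prime (p i) & forall i, (0 < e i)%N],
        s = (\prod_(i < k) p i ^ e i)%N,
        forall i, isobicyclic (p i ^ e i)%N (Si i) (xi i) (yi i)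
      & cart_prod_triple S x y Si xi yi].
Proof.
move=> isoS nilS; have [ox oy _ _ _] := isoS; have [_ _ oS] := isobicyclic_gen isoS.
have s_gt0 : (0 < s)%N by rewrite -ox order_gt0.
pose p (i : 'I_(size (primes s))) := tnth (in_tuple (primes s)) i.
have p_s i : p i \in primes s by apply: mem_tnth.
have p_pr i : prime (p i) by have := p_s i; rewrite mem_primes => /and3P[].
exists (size (primes s)), p, (fun i => logn (p i) s), (fun i => 'O_(p i)(S)%G),
  (fun i => x.`_(p i)), (fun i => y.`_(p i)); split; first split=> //.
- by apply/tuple_uniqP/primes_uniq.
- by move=> i; rewrite logn_gt0.
- by rewrite [LHS](prod_prime_decomp s_gt0) prime_decompE big_map big_tnth.
- move=> i; have [H [_ hallH isoH]] := isobicyclic_Hall (p i) isoS.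
  rewrite -p_part; rewrite (_ : 'O_(p i)(S)%G = H) //.
  by apply/val_inj/esym/(nilpotent_Hall_pcore nilS hallH).
split.
(* The Fitting subgroup is defined as the product of the cores over the primes of [#|S| = s * s],
   which are those of [s]. *)
- by have := nilpotent_Fitting nilS; rewrite /Fitting oS mulnn primesX // big_tnth.
- by rewrite -[LHS](prod_constt_primes ox) big_tnth.
- by rewrite -[LHS](prod_constt_primes oy) big_tnth.
Qed.

Theorem theorem4p1 (gT : finGroupType) (n : nat) (G : {group gT}) (x y : gT) :
  (0 < n)%N -> isobicyclic n G x y ->
  exists (s t : nat) (T S : {group gT}) (xT yT xS yS : gT) (lam : nat),
    [/\ n = (s * t)%N, coprime s t,
        sdprod_triple G x y t T xT yT S xS yS lam,
        (* (iii) (T, xT, yT) is (isomorphic to) the standard t-isobicyclic triple *)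
        triple_iso T xT yT (stdT t) (std_x t) (std_y t)
      & (* (ii) (S, xS, yS) is an s-isobicyclic triple which is a cartesian
           product of p_i^e_i-isobicyclic triples, s = prod p_i^e_i *)
        isobicyclic s S xS yS /\
        exists (k : nat) (p e : 'I_k -> nat) (Si : 'I_k -> {group gT})
               (xi yi : 'I_k -> gT),
          [/\ [/\ injective p, forall i, prime (p i) & forall i, (0 < e i)%N],
              s = (\prod_(i < k) p i ^ e i)%N,
              forall i, isobicyclic (p i ^ e i)%N (Si i) (xi i) (yi i)
            & cart_prod_triple S xS yS Si xi yi]].
Proof.
move=> _ isoG; have [f [_ _ fx fy]] := isobicyclic_swap isoG.
have [Gx Gy _] := isobicyclic_gen isoG.
have [s [t [i [j [l [T [S [[def_n co_st defG def_x def_y]]]]]]]]] :=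
  isobicyclic_decomposition isoG.
case=> [[defS oS nilS defT oT] [_ co_l _ act]].
have isoS : isobicyclic s S (x ^+ i) (y ^+ i) by rewrite -oS; apply: isobicyclic_sub isoG _.
have oTy : #[y ^+ j] = t by rewrite -oT !orderXgcd; case: isoG => -> ->.
have fixX (z : gT) a b : (z ^+ a) ^ (z ^+ b) = z ^+ a.
  by apply/conjg_fixP/commgP/commuteX2.
exists s, t, T, S, (x ^+ j), (y ^+ j), (x ^+ i), (y ^+ i), l; split=> //.
- split=> //; split=> //.
  (* The action of [y ^+ i] on [x ^+ j] is the image under the swap of that of [x ^+ i] on
     [y ^+ j]. *)
  by have := congr1 f act; rewrite morphJ ?groupX // !morphX ?groupX // fx fy.
- exact: homocyclic_triple_iso.
by split=> //; apply: nilpotent_isobicyclic_cart_prod.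
Qed.
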